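(* There exist constants $c_2>c_1>0$ such that, if $G$ is chosen uniformly at random from the set $\mathcal{G}_n$ of all $2^{\binom n2}$ labelled graphs on the vertex set $[n]=\{1,\dots,n\}$, then with probability tending to $1$ as $n\to\infty$, \[ c_1\frac{n}{\log n}<f_{\mathrm{Kn}}(G)<c_2\frac{n}{\log n}. \]
   Context: A Kneser representation of rank $k$ of a graph $G=(V,E)$ is an assignment $v\mapsto A_v$ of pairwise distinct $k$-element sets to the vertices such that for distinct $u,v$, $A_u\cap A_v=\emptyset$ if and only if $uv\in E$ (equivalently, $G$ is an induced subgraph of a Kneser graph $\mathrm{Kn}(s,k)$ for some $s$). The Kneser rank $f_{\mathrm{Kn}}(G)$ is the smallest $k$ such that $G$ has a Kneser representation of rank $k$. *)

(* Defs.v *)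
From HB Require Import structures.
From mathcomp Require Import all_boot all_order all_algebra.
From mathcomp Require Import boolp reals.

Set Implicit Arguments.
Unset Strict Implicit.
Unset Printing Implicit Defensive.

Import Order.TTheory GRing.Theory Num.Theory.

Record sgraph (V : finType) := SGraph {
  edges : {set {set V}};
  _ : [forall e in edges, #|e| == 2]
}.

HB.instance Definition _ (V : finType) := [isSub for @edges V].
HB.instance Definition _ (V : finType) := [Finite of sgraph V by <:].

Definition adj (V : finType) (G : sgraph V) (u v : V) : bool :=
  [set u; v] \in edges G.

Lemma card_sgraph (V : finType) : #|{: sgraph V}| = 2 ^ 'C(#|V|, 2).
Proof.
rewrite -card_draws -card_powerset -(card_image (@val_inj _ _ (sgraph V))).
apply: eq_card => E.
rewrite powersetE; apply/imageP/subsetP => [[G _ ->] e eG|sE].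
  by rewrite inE; apply: (forall_inP (valP G)).
have hE : [forall e in E, #|e| == 2].
  by apply/forall_inP => e /sE; rewrite inE.
by exists (SGraph hE).
Qed.

Definition kneser_representation (V T : finType) (G : sgraph V) (k : nat)
    (A : V -> {set T}) : Prop :=
  [/\ injective A,
      forall v, #|A v| = k &
      forall u v, u != v -> (A u :&: A v = set0 <-> adj G u v)].

(* The elements of the sets are taken in [s], without loss of generality since
   the union of the sets A_v is finite. *)
Definition has_kneser_representation (V : finType) (G : sgraph V) (k : nat) : Prop :=
  exists (s : nat) (A : V -> {set 'I_s}), kneser_representation G k A.

Lemma ex_kneser_representation (V : finType) (G : sgraph V) :
  exists k, `[< has_kneser_representation G k >].
Proof.
pose T : finType := ({set V} + V * V)%type.
pose f (v u : V) : T := if adj G v u then inr (v, u) else inl [set v; u].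
have adjvv v : adj G v v = false.
  rewrite /adj setUid; apply/negP => /(forall_inP (valP G)).
  by rewrite cards1.
have f_inj v : injective (f v).
  move=> u w; rewrite /f; case: ifP => _; case: ifP => _ // [] //.
  move/setP => e; have := e u; have := e w; rewrite !inE !eqxx !orbT.
  case: (eqVneq w v) => [->|_] /=; first by move=> _; rewrite orbb => /esym/eqP.
  by move/eqP => ->.
pose B v := [set enum_rank (f v u) | u : V].
have fB v u : enum_rank (f v u) \in B v by apply: imset_f.
have mB v x : x \in B v -> exists u, x = enum_rank (f v u).
  by case/imsetP => u _ ->; exists u.
exists #|V|; apply/asboolP; exists #|T|, B; split.
- move=> u v e; have := fB u u; rewrite e => /mB[w /enum_rank_inj].
  rewrite /f adjvv; case: ifP => // _ [] /setP/(_ v).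
  by rewrite !inE eqxx orbb => /eqP.
- move=> v; rewrite card_imset // => x y /enum_rank_inj; exact: f_inj.
- move=> u v uv; split=> [e|auv].
    apply/negPn/negP => nuv.
    have : enum_rank (f u v) \in B u :&: B v.
      rewrite inE fB /=; suff -> : f u v = f v u by [].
      rewrite /f /adj [[set v; u]]finset.setUC -/(adj G u v).
      by rewrite (negbTE nuv).
    by rewrite e inE.
  apply/setP => x; rewrite !inE; apply/negP => /andP[/mB[a ->] /mB[b]].
  move/enum_rank_inj; rewrite /f; case: ifP => ha; case: ifP => hb // [].
    by move=> e; rewrite e eqxx in uv.
  move=> /setP e; have := e u; have := e v; rewrite !inE !eqxx /= orbC.
  rewrite [v == u]eq_sym (negbTE uv) orbF /= => /eqP va.
  by rewrite -va auv in ha.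
Qed.

Definition kneser_rank (V : finType) (G : sgraph V) : nat :=
  ex_minn (ex_kneser_representation G).

Definition uniform_prob (R : realType) (T : finType) (P : pred T) : R :=
  (#|P|%:R / #|T|%:R)%R.

(* Main.v *)
(* Write a representation as a cover of the non-edges of [G] by independent sets;
   its rank is the largest number of these sets through one vertex.
   Lower bound: a graph of rank at most [k] is determined by the equality pattern
   of [n k] incidences, so there are at most [(n k) ^ (n k)] of them.
   Upper bound: with overwhelming probability every set of at least [C sqrt n]
   vertices has a vertex non-adjacent to a constant fraction of it, so every such
   set with a factor [16 ^ t] to spare contains an independent set of size [t], and
   any set [W] is partitioned into about [|W| / t] independent sets, where
   [t = c log n]. Partition the vertices into independent sets [C]; for each [S] in
   [C], partition the vertices outside [C] whose non-neighbours in [C] are exactly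
   [S] into independent sets [D], and cover by the sets [S :|: D]. A vertex meets
   one [D] for each [C] not containing it, and at most [n / t] up to lower order
   pairs [(S, D)] for its own [C]. *)
Require Import Defs.
From mathcomp Require Import all_boot boolp zify.

Set Implicit Arguments.
Unset Strict Implicit.
Unset Printing Implicit Defensive.

(** * Kneser representations and covers by independent sets *)

Section Representations.
Variables (V : finType) (G : sgraph V).

Lemma adj_sym u v : adj G u v = adj G v u.
Proof. by rewrite /adj setUC. Qed.

Lemma adj_irr v : adj G v v = false.
Proof.
rewrite /adj setUid; apply/negP => /(forall_inP (valP G)).
by rewrite cards1.
Qed.

(** Private elements tagged by [v] bring each [B v] to the common size without creating
    intersections. The size is [k.+1] so that each [v] receives at least one of them, which makes
    the padded sets distinct even where [B] is not injective. *)
Lemma pad_representation (T : finType) (B : V -> {set T}) (k : nat) :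
  (forall v, #|B v| <= k) ->
  (forall u v, u != v -> (B u :&: B v = set0 <-> adj G u v)) ->
  has_kneser_representation G k.+1.
Proof.
move=> leBk dB.
pose U : finType := (T + V * 'I_k.+1)%type.
pose m v := k.+1 - #|B v|.
have lem v : m v <= k.+1 by exact: leq_subr.
pose pad v : {set U} := [set inr (v, widen_ord (lem v) j) | j : 'I_(m v)].
pose A v : {set U} := [set inl x | x in B v] :|: pad v.
have inA v x : (inl x \in A v) = (x \in B v).
  rewrite inE mem_imset ?orbF; last by move=> ? ? [].
  by rewrite orbC; case: imsetP => [[]|].
have inpad v u (j : 'I_k.+1) : (inr (u, j) \in A v) = (u == v) && (j < m v).
  rewrite inE; case: imsetP => [[]//|_] /=.
  apply/imsetP/andP => [[i _ [-> ->]]|[/eqP-> lt]]; first by rewrite eqxx /=.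
  by exists (Ordinal lt) => //; congr (inr (_, _)); apply: val_inj.
exists #|U|, (fun v => [set enum_rank x | x in A v]); split.
- move=> u v /= /imset_inj - /(_ enum_rank_inj) /setP/(_ (inr (u, ord0))).
  by rewrite !inpad eqxx /= subn_gt0 ltnS leBk => /esym/andP[/eqP].
- move=> v; rewrite card_imset; last exact: enum_rank_inj.
  rewrite cardsU disjoint_setI0 ?cards0 ?subn0; last first.
    rewrite disjoint_subset; apply/subsetP => _ /imsetP[x _ ->].
    by rewrite inE; apply/imsetP => -[].
  rewrite !card_imset; last by move=> ? ? [].
    by rewrite card_ord subnKC //; apply: leqW.
  by move=> i j [e]; apply: val_inj.
- move=> u v uv; rewrite -dB // -imsetI; last first.
    by move=> ? ? _ _; exact: enum_rank_inj.
  split=> [/eqP|dis]; last first.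
    apply/eqP; rewrite imset_eq0; apply/eqP/setP => -[x|[w j]]; last first.
      rewrite in_setI !inpad [RHS]in_set0; apply/negP => /andP[/andP[/eqP-> _]].
      by rewrite (negbTE uv).
    by rewrite in_setI !inA -in_setI dis !inE.
  rewrite imset_eq0 => /eqP dis; apply/setP => x.
  by have /setP/(_ (inl x)) := dis; rewrite in_setI !inA -in_setI !inE.
Qed.

Lemma has_representation_kneser_rank :
  has_kneser_representation G (kneser_rank G).
Proof. by rewrite /kneser_rank; case: ex_minnP => k /asboolP. Qed.

Lemma kneser_rank_le k : has_kneser_representation G k -> kneser_rank G <= k.
Proof. by rewrite /kneser_rank; case: ex_minnP => m _ + /asboolP; apply. Qed.

Lemma has_representation_gt k :
  kneser_rank G < k -> has_kneser_representation G k.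
Proof.
case: k => // k; rewrite ltnS => le.
have [s [A [_ cA dA]]] := has_representation_kneser_rank.
by apply: (pad_representation (B := A)) => // v; rewrite cA.
Qed.

Definition indep (C : {set V}) := [forall u in C, forall v in C, ~~ adj G u v].

Lemma indepP (C : {set V}) : reflect {in C &, forall u v, ~~ adj G u v} (indep C).
Proof.
apply: (iffP forall_inP) => [h u v uC vC|h u uC].
  by have /forall_inP := h u uC; apply.
by apply/forall_inP => v vC; apply: h.
Qed.

(* An independent set of [G] is a possible trace of one ground element, so a
   Kneser representation is a cover of the non-edges by independent sets. *)
Lemma kneser_rank_cover (F : {set {set V}}) (k : nat) :
  {in F, forall C : {set V}, indep C} ->
  (forall u v, u != v -> ~~ adj G u v ->
     exists2 C, C \in F & (u \in C) && (v \in C)) ->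
  (forall v, #|[set C in F | v \in C]| <= k) ->
  kneser_rank G <= k.+1.
Proof.
move=> iF cF dF; apply: kneser_rank_le.
apply: (pad_representation (B := fun v => [set C in F | v \in C])) => //.
move=> u v uv; split=> [dis|auv].
  apply/negPn/negP => /(cF _ _ uv) [C CF /andP[uC vC]].
  by have /setP/(_ C) := dis; rewrite !inE CF uC vC.
apply/setP => C; rewrite !inE; apply/negP => /andP[/andP[CF uC] /andP[_ vC]].
by have /indepP/(_ u v uC vC) := iF _ CF; rewrite auv.
Qed.

(** * Rich graphs: independent sets, partitions and covers *)

Definition rich (m : nat) := [forall W : {set V}, (m <= #|W|) ==>
  [exists w in W, #|W| <= 16 * #|[set u in W | (w != u) && ~~ adj G w u]|]].

Section Rich.
Variables (m t : nat).
Hypotheses (m_gt0 : 0 < m) (t_gt0 : 0 < t) (richG : rich m).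

(** Greedy choice: take the vertex [w] given by richness and continue inside its non-neighbours in
    [W], losing a factor 16 per step. The clause [w != u] in [rich] makes each chosen vertex new. *)
Lemma rich_indep s (W : {set V}) : 16 ^ s * m <= #|W| ->
  exists C : {set V}, [/\ C \subset W, indep C & #|C| = s].
Proof.
elim: s W => [|s IHs] W leW.
  exists set0; rewrite sub0set cards0; split=> //.
  by apply/indepP => u v; rewrite inE.
have /implyP/(_ (leq_trans _ leW)) := forallP richG W.
rewrite leq_pmull ?expn_gt0 // => /(_ isT)/exists_inP[w wW leN].
set N := [set u in W | _] in leN.
have [|C [CN iC cC]] := IHs N.
  by rewrite -(leq_pmul2l (m := 16)) // mulnA -expnS (leq_trans leW).
have NW : N \subset W by apply/subsetP => u; rewrite inE => /andP[].
exists (w |: C); split.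
- by rewrite subUset sub1set wW (subset_trans CN).
- have wN u : u \in C -> ~~ adj G w u.
    by move=> /(subsetP CN); rewrite inE => /and3P[].
  apply/indepP => u v /setU1P[->|uC] /setU1P[->|vC].
  + by rewrite adj_irr.
  + exact: wN.
  + by rewrite adj_sym; exact: wN.
  + exact: (indepP _ iC).
- rewrite cardsU1 cC; case: (boolP (w \in C)) => // /(subsetP CN).
  by rewrite inE eqxx andbF.
Qed.

Definition indep_partition (W : {set V}) (P : {set {set V}}) :=
  [/\ partition P W, {in P, forall C : {set V}, indep C && (#|C| <= t)} &
      t * #|P| <= #|W| + t * (16 ^ t * m)].

(** Independent [t]-sets are removed while [16 ^ t * m] vertices remain; the rest becomes
    singletons, whose number is the error term. *)
Lemma ex_indep_partition W : exists P, indep_partition W P.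
Proof.
have [n] := ubnP #|W|; elim: n W => // n IHn W; rewrite ltnS => leW.
have [small|large] := ltnP #|W| (16 ^ t * m).
  exists [set [set x] | x in W]; split.
  - apply/and3P; split.
    + rewrite cover_imset; apply/eqP/setP => x; apply/bigcupP/idP.
        by case=> y yW /set1P->.
      by move=> xW; exists x; rewrite ?set11.
    + apply/trivIsetP => _ _ /imsetP[x _ ->] /imsetP[y _ ->] xy.
      by rewrite disjoints1 in_set1; apply: contraNneq xy => ->.
    + by apply/imsetP => -[x _ /setP/(_ x)]; rewrite !inE eqxx.
  - move=> _ /imsetP[x _ ->]; rewrite cards1 t_gt0 andbT.
    by apply/indepP => u v /set1P-> /set1P->; rewrite adj_irr.
  - rewrite card_imset; last exact: set1_inj.
    by rewrite (leq_trans _ (leq_addl _ _)) // leq_mul2l (ltnW small) orbT.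
have [C [CW iC cC]] := rich_indep large.
have cD : #|W :\: C| + t = #|W| by rewrite -(cardsID C W) (setIidPr CW) cC addnC.
have [|P [pP iP cP]] := IHn (W :\: C).
  by rewrite (leq_trans _ leW) // -cD -addn1 leq_add2l.
exists (C |: P); split.
- have -> : W = C :|: (W :\: C) by rewrite setDE setUIr setUCr setIT; apply/esym/setUidPr.
  apply: partitionU1 => //; first by rewrite -card_gt0 cC.
  by rewrite disjoint_sym; apply/setDidPl; rewrite setDDl setUid.
- move=> D /setU1P[->|/iP//]; by rewrite iC cC leqnn.
- rewrite cardsU1 mulnDr; apply: (@leq_trans (t + (#|W :\: C| + t * (16 ^ t * m)))).
    by rewrite leq_add // -[X in _ <= X]muln1 leq_mul2l leq_b1 orbT.
  by rewrite addnA [t + _]addnC cD.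
Qed.

Definition coneighbors (C : {set V}) (v : V) := [set u in C | ~~ adj G u v].

Definition pattern (C S : {set V}) := [set v in ~: C | coneighbors C v == S].

Lemma sum_pattern (C : {set V}) :
  \sum_(S in powerset C) #|pattern C S| <= #|V|.
Proof.
rewrite -[X in _ <= X]sum1_card.
rewrite (partition_big (fun v => coneighbors C v) (mem (powerset C))) /=; last first.
  by move=> v _; rewrite powersetE; apply/subsetP => u; rewrite inE => /andP[].
apply: leq_sum => S _; rewrite -sum1_card big_mkcond [X in _ <= X]big_mkcond /=.
by apply: leq_sum => v _; rewrite !inE; case: (_ \notin _).
Qed.

Lemma rich_cover : exists F : {set {set V}},
  [/\ {in F, forall C : {set V}, indep C},
      forall u v, u != v -> ~~ adj G u v ->
        exists2 C, C \in F & (u \in C) && (v \in C) &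
      forall v, t * #|[set C in F | v \in C]| <=
        t + 2 * #|V| + 2 ^ t.+1 * (t * (16 ^ t * m))].
Proof.
have [Q PQ] := fin_all_exists ex_indep_partition.
have cov (W : {set V}) v : v \in W -> v \in cover (Q W).
  by have [/cover_partition-> _ _] := PQ W.
have tri W : trivIset (Q W) by have [/and3P[]] := PQ W.
have sub W D : D \in Q W -> D \subset W.
  move=> DQ; apply/subsetP => x xD; have [/cover_partition <- _ _] := PQ W.
  by apply/bigcupP; exists D.
pose P := Q setT.
have covP v : v \in cover P by apply: cov; rewrite inE.
pose ext C S := [set S :|: D | D in Q (pattern C S)].
pose F := P :|: \bigcup_(C in P) \bigcup_(S in powerset C) ext C S.
exists F; split.
- move=> X /setUP[/(let: And3 _ h _ := PQ setT in h X)/andP[]//|].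
  case/bigcupP => C CP /bigcupP[S]; rewrite powersetE => SC /imsetP[D DQ ->].
  have [_ /(_ _ DQ)/andP[/indepP iD _] _] := PQ (pattern C S).
  have [_ /(_ _ CP)/andP[/indepP iC _] _] := PQ setT.
  have SD u v : u \in S -> v \in D -> ~~ adj G u v.
    move=> uS /(subsetP (sub _ _ DQ)); rewrite !inE => /andP[_ /eqP e].
    by move: uS; rewrite -e inE => /andP[].
  apply/indepP => u v /setUP[uS|uD] /setUP[vS|vD].
  + by apply: iC; apply: (subsetP SC).
  + exact: SD.
  + by rewrite adj_sym; exact: SD.
  + exact: iD.
- move=> u v uv nuv; pose C := pblock P u.
  have CP : C \in P by apply: pblock_mem.
  have uC : u \in C by rewrite mem_pblock.
  case: (boolP (v \in C)) => vC.
    by exists C; rewrite ?uC // inE CP.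
  (* Here [u] lies in [S] because it is not adjacent to [v], and [v] lies in [D], so [S :|: D]
     covers the pair. *)
  pose S := coneighbors C v; pose D := pblock (Q (pattern C S)) v.
  have vW : v \in pattern C S by rewrite !inE vC eqxx.
  exists (S :|: D); last first.
    by rewrite !inE uC nuv mem_pblock (cov _ _ vW) orbT.
  rewrite inE; apply/orP; right; apply/bigcupP; exists C => //.
  apply/bigcupP; exists S.
    by rewrite powersetE; apply/subsetP => x; rewrite inE => /andP[].
  by apply: imset_f; apply: pblock_mem; apply: cov.
move=> v; pose C0 := pblock P v.
(* If a set [S :|: D] built from [C] contains [v] through [D], then [C] determines both [S] and [D],
   and the set is [g C]. If it contains [v] through [S], then [C] is the class [C0] of [v]. *)
pose g C := let S := coneighbors C v in S :|: pblock (Q (pattern C S)) v.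
pose X := C0 |: ([set g C | C in P] :|: \bigcup_(S in powerset C0) ext C0 S).
have sX : [set C in F | v \in C] \subset X.
  apply/subsetP => Y; rewrite inE => /andP[/setUP[YP vY|]].
    by rewrite !inE -(def_pblock (tri setT) YP vY) eqxx.
  case/bigcupP => C CP /bigcupP[S SC YE] vY; rewrite !inE; apply/orP; right.
  have /imsetP[D DQ defY] := YE; move: vY; rewrite defY => /setUP[vS|vD].
    have vC : v \in C by move: SC; rewrite powersetE => /subsetP; apply.
    apply/orP; right; rewrite -defY; apply/bigcupP; exists S => //.
      by rewrite /C0 (def_pblock (tri setT) CP vC).
    by rewrite /C0 (def_pblock (tri setT) CP vC).
  apply/orP; left; apply/imsetP; exists C => //.
  have := subsetP (sub _ _ DQ) v vD; rewrite !inE => /andP[_ /eqP e].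
  by rewrite /g e (def_pblock (tri _) DQ vD).
have cC0 : #|C0| <= t.
  have [_ /(_ C0) h _] := PQ setT.
  by case/andP: (h (pblock_mem (covP v))).
(* The patterns of [C0] are disjoint, so the main terms add up to at most [#|V|]; the error term is
   paid once for each of at most [2 ^ t] subsets [S]. *)
have cext : t * #|\bigcup_(S in powerset C0) ext C0 S| <=
    #|V| + 2 ^ t * (t * (16 ^ t * m)).
  apply: (@leq_trans (t * \sum_(S in powerset C0) #|Q (pattern C0 S)|)).
    rewrite leq_mul2l; apply/orP; right.
    elim/big_rec2: _ => [|S y Z _ IH]; first by rewrite cards0.
    rewrite (leq_trans (leq_card_setU _ _).1) // leq_add //.
    exact: leq_imset_card.
  rewrite big_distrr /=.
  apply: (@leq_trans (\sum_(S in powerset C0) (#|pattern C0 S| + t * (16 ^ t * m)))).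
    by apply: leq_sum => S _; have [] := PQ (pattern C0 S).
  rewrite big_split /= leq_add ?sum_pattern // sum_nat_const card_powerset.
  by rewrite leq_mul2r leq_exp2l // cC0 orbT.
have cP : t * #|P| <= #|V| + t * (16 ^ t * m).
  by have [_ _] := PQ setT; rewrite cardsT.
have cX : #|X| <= 1 + (#|P| + #|\bigcup_(S in powerset C0) ext C0 S|).
  rewrite (leq_trans (leq_card_setU _ _).1) // cards1 leq_add2l.
  by rewrite (leq_trans (leq_card_setU _ _).1) // leq_add2r leq_imset_card.
have := leq_mul (leqnn t) (leq_trans (subset_leq_card sX) cX).
move=> /leq_trans; apply.
rewrite !mulnDr muln1 -addnA leq_add2l.
apply: leq_trans (leq_add cP cext) _.
have : t * (16 ^ t * m) <= 2 ^ t * (t * (16 ^ t * m)).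
  by rewrite leq_pmull // expn_gt0.
rewrite expnS; lia.
Qed.

(** The second [t] pays for the extra element in [kneser_rank_cover]. *)
Lemma rich_kneser_rank :
  t * kneser_rank G <= 2 * t + 2 * #|V| + 2 ^ t.+1 * (t * (16 ^ t * m)).
Proof.
have [F [iF cF dF]] := rich_cover.
pose K := t + 2 * #|V| + 2 ^ t.+1 * (t * (16 ^ t * m)).
have := @kneser_rank_cover F (K %/ t) iF cF.
have h v : #|[set C in F | v \in C]| <= K %/ t by rewrite leq_divRL // mulnC dF.
move=> /(_ h) le; apply: (@leq_trans (t * (K %/ t).+1)).
  by rewrite leq_mul2l le orbT.
rewrite mulnS mulnC; have := leq_divM K t; rewrite /K; lia.
Qed.

End Rich.
End Representations.

(** * Large deviations for random subsets *)

Lemma sum_expn_cardsI (T : finType) (D P : {set T}) : P \subset D ->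
  (\sum_(E in powerset D) 2 ^ #|E :&: P|) * 2 ^ #|P| = 3 ^ #|P| * 2 ^ #|D|.
Proof.
move=> PD.
(* [f e] is the weight of choosing [e] and 1 that of omitting it. The factors are 3 on [P], 2 on the
   rest of [D] and 1 elsewhere; weight 0 discards every [E] not inside [D]. *)
pose f e := if e \in D then if e \in P then 2 else 1 else 0.
have -> : \sum_(E in powerset D) 2 ^ #|E :&: P| = \prod_e (f e + 1).
  rewrite bigA_distr big_mkcond; apply: eq_bigr => E _; rewrite powersetE.
  have [ED|/subsetPn[x xE xD]] := ifPn; last first.
    by rewrite (bigD1 x) //= xE /f (negbTE xD) mul0n.
  rewrite -prod_nat_const big_mkcond; apply: eq_bigr => e _; rewrite inE /f.
  by case: (boolP (e \in E)) => //= /(subsetP ED) ->.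
have -> : \prod_e (f e + 1) = 3 ^ #|P| * 2 ^ #|D :\: P|.
  rewrite -!prod_nat_const [X in _ = X * _]big_mkcond [X in _ = _ * X]big_mkcond -big_split /=.
  apply: eq_bigr => e _; rewrite inE /f.
  by case: (boolP (e \in P)) => [/(subsetP PD) ->|_] //=; case: ifP.
by rewrite -mulnA -expnD addnC -(cardsID P D) (setIidPr PD).
Qed.

(* Chernoff bound, from the exponential moment at base 2 and [3^8 <= 2^13]. *)
Lemma card_dense_subsets (T : finType) (D P : {set T}) : P \subset D ->
  #|[set E in powerset D | 7 * #|P| <= 8 * #|E :&: P|]| ^ 4 * 2 ^ #|P| <=
    2 ^ (4 * #|D|).
Proof.
move=> PD; set X := [set E in _ | _]; set p := #|P|.
(* The ceiling of 7p/8, an integer threshold for Markov's inequality. *)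
pose y := (7 * p + 7) %/ 8.
have y_ge : 7 * p <= 8 * y by rewrite /y; lia.
have Xy : #|X| * 2 ^ y * 2 ^ p <= 3 ^ p * 2 ^ #|D|.
  rewrite -sum_expn_cardsI // leq_mul2r; apply/orP; right.
  rewrite -sum_nat_const big_mkcond [X in _ <= X]big_mkcond /=.
  apply: leq_sum => E _; rewrite [in X in X <= _]inE; case: ifPn => //= /andP[-> h].
  by rewrite leq_exp2l // /y; move: h; rewrite -/p; lia.
have h8 : (3 ^ p) ^ 8 <= 2 ^ (13 * p).
  have [->//|p_gt0] := posnP p.
  by rewrite -expnM [p * 8]mulnC !expnM leq_exp2r.
(* The eighth power of [Xy] has at least [2 ^ (15 * p)] on the left against [2 ^ (13 * p)] on the
   right; the surplus [2 ^ (2 * p)] is the square of the claimed factor. *)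
have := Xy; rewrite -(@leq_exp2r _ _ 8) // !expnMn => Xy8.
rewrite -(@leq_exp2r _ _ 2) // expnMn -!expnM.
have pos : 0 < 2 ^ (13 * p) by rewrite expn_gt0.
rewrite -(leq_pmul2r pos); apply: leq_trans (_ : _ <= (3 ^ p) ^ 8 * (2 ^ #|D|) ^ 8) _.
  apply: leq_trans Xy8; rewrite -mulnA -[X in _ <= X]mulnA; apply: leq_mul => //.
  by rewrite -!expnM -!expnD leq_exp2l //; lia.
rewrite mulnC; apply: leq_mul => //.
by rewrite -expnM leq_exp2l //; lia.
Qed.

(** * Counting graphs that are not rich or have small rank *)

Section Counting.
Variable V : finType.
Implicit Types G : sgraph V.

Lemma card_edges_imset (A : {set sgraph V}) : #|A| = #|@edges V @: A|.
Proof. by rewrite card_imset //; exact: val_inj. Qed.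

Let pairs (W : {set V}) := [set e : {set V} | e \subset W & #|e| == 2].

Lemma edges_sub G : edges G \subset pairs setT.
Proof.
apply/subsetP => e eG; rewrite inE subsetT /=.
by have /forall_inP := valP G; apply.
Qed.

(** A set [W] violating richness spans at least 7/8 of its pairs as edges. As [W] has at least
    [8 * #|V|] pairs, the Chernoff bound gives this probability at most [2 ^ (- 2 * #|V|)], and a
    union bound over the sets [W] costs a factor [2 ^ #|V|]. *)
Lemma card_not_rich m : 8 * #|V| <= 'C(m, 2) ->
  #|[set G : sgraph V | ~~ rich G m]| * 2 ^ #|V| <= 2 ^ 'C(#|V|, 2).
Proof.
move=> lem; rewrite card_edges_imset.
pose N := 'C(#|V|, 2).
have cD : #|pairs setT| = N by rewrite cards_draws cardsT.
pose X W := [set E in powerset (pairs setT) | 7 * #|pairs W| <= 8 * #|E :&: pairs W|].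
have sX : @edges V @: [set G : sgraph V | ~~ rich G m] \subset
    \bigcup_(W in [set W : {set V} | m <= #|W|]) X W.
  apply/subsetP => _ /imsetP[G + ->]; rewrite inE negb_forall => /existsP[W].
  rewrite negb_imply => /andP[mW]; rewrite negb_exists_in => /forall_inP h.
  apply/bigcupP; exists W; rewrite !inE // edges_sub /=.
  (* [S] holds ordered non-adjacent pairs, fewer than 1/16 of [#|W|] at each vertex, hence at most
     1/8 of the number of unordered pairs. *)
  pose S := [set q : V * V | [&& q.1 \in W, q.2 \in W, q.1 != q.2 & ~~ adj G q.1 q.2]].
  have sS : pairs W :\: edges G \subset [set [set q.1; q.2] | q in S].
    apply/subsetP => e; rewrite !inE => /and3P[eG eW /cards2P[u [v [uv def_e]]]].
    apply/imsetP; exists (u, v) => //; rewrite inE /= uv /adj -def_e eG /= andbT.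
    by rewrite !(subsetP eW) // def_e !inE eqxx ?orbT.
  have cS : 16 * #|S| <= #|W| * #|W|.-1.
    have -> : #|S| = \sum_(w in W) #|[set u in W | (w != u) && ~~ adj G w u]|.
      rewrite -sum1_card.
      under [RHS]eq_bigr do rewrite -sum1_card.
      rewrite pair_big_dep /=; apply: eq_bigl => -[u v]; rewrite !inE /=.
      by [].
    rewrite big_distrr -sum_nat_const /=; apply: leq_sum => w wW.
    by move: (h _ wW); rewrite -ltnNge; lia.
  have cP : #|pairs W| = 'C(#|W|, 2) by rewrite cards_draws.
  have := leq_trans (subset_leq_card sS) (leq_imset_card _ _).
  have := cardsID (edges G) (pairs W); rewrite setIC.
  have : #|pairs W| * 2 = #|W| * #|W|.-1.
    by rewrite cP mulnC -mul_bin_diag bin1.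
  move: cS; move: (_ * _.-1) #|S| #|pairs W| #|_ :&: _| #|_ :\: _| => *; lia.
have cX W : W \in [set W : {set V} | m <= #|W|] -> #|X W| * 2 ^ (2 * #|V|) <= 2 ^ N.
  rewrite inE => mW.
  have sP : pairs W \subset pairs setT.
    by apply/subsetP => e; rewrite !inE subsetT => /andP[].
  have := card_dense_subsets sP; rewrite -/(X W) cD => h.
  rewrite -(@leq_exp2r _ _ 4) // expnMn -!expnM [N * 4]mulnC.
  apply: leq_trans h; rewrite leq_mul2l leq_exp2l // cards_draws.
  apply/orP; right; rewrite mulnAC; apply: leq_trans lem _.
  exact: leq_bin2l.
have le : #|@edges V @: [set G : sgraph V | ~~ rich G m]| <= \sum_(W in [set W : {set V} | m <= #|W|]) #|X W|.
  apply: leq_trans (subset_leq_card sX) _.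
  elim/big_rec2: _ => [|W y Z _ IH]; first by rewrite cards0.
  by rewrite (leq_trans (leq_card_setU _ _).1) // leq_add2l.
have pos : 0 < 2 ^ #|V| by rewrite expn_gt0.
rewrite -(leq_pmul2r pos) -mulnA -expnD addnn -mul2n.
apply: leq_trans (leq_mul le (leqnn _)) _.
rewrite big_distrl /=.
apply: (@leq_trans (\sum_(W in [set W : {set V} | m <= #|W|]) 2 ^ N)).
  by apply: leq_sum => W; exact: cX.
rewrite sum_nat_const mulnC leq_mul2l.
apply/orP; right; apply: leq_trans (max_card _) _.
by rewrite -cardsT -powersetT card_powerset cardsT.
Qed.

(* A representation of rank [k] enters adjacency only through the equality
   pattern of its [|V| k] incidences, recorded by a choice of representatives. *)
Lemma card_kneser_rank_lt k :
  #|[set G : sgraph V | kneser_rank G < k]| <= (#|V| * k) ^ (#|V| * k).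
Proof.
rewrite card_edges_imset.
pose I : finType := (V * 'I_k)%type.
pose dec (phi : {ffun I -> I}) := [set [set q.1; q.2] | q : V * V &
  (q.1 != q.2) && [forall i, forall j, phi (q.1, i) != phi (q.2, j)]].
suff s : @edges V @: [set G : sgraph V | kneser_rank G < k] \subset dec @: setT.
  apply: leq_trans (subset_leq_card s) _; apply: leq_trans (leq_imset_card _ _) _.
  by rewrite cardsT card_ffun card_prod card_ord.
apply/subsetP => _ /imsetP[G + ->]; rewrite inE => /has_representation_gt.
move=> [s [A [_ cA dA]]].
pose e (p : I) : 'I_s := enum_val (cast_ord (esym (cA p.1)) p.2).
have eA v i : e (v, i) \in A v by exact: enum_valP.
have Ae v x : x \in A v -> exists i, x = e (v, i).
  move=> xA; exists (cast_ord (cA v) (enum_rank_in xA x)).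
  by rewrite /e /= cast_ordK enum_rankK_in.
(* [p] itself satisfies the test, so the default never occurs, and the chosen representative depends
   only on [e p]. *)
pose phi := [ffun p : I => odflt p [pick q | e q == e p]].
have ephi p : e (phi p) = e p.
  by rewrite ffunE; case: pickP => //= q /eqP.
have phie p q : e p = e q -> phi p = phi q.
  rewrite !ffunE => ->; case: pickP => //= /(_ q); by rewrite eqxx.
apply/imsetP; exists phi; rewrite ?inE //.
have adjE u v : u != v -> adj G u v = [forall i, forall j, phi (u, i) != phi (v, j)].
  move=> uv; apply/idP/forallP => [/(dA _ _ uv) dis i|h].
    apply/forallP => j; apply/eqP => /(congr1 e); rewrite !ephi => eq.
    have : e (u, i) \in A u :&: A v by rewrite inE eA eq eA.
    by rewrite dis inE.
  apply/dA => //; apply/setP => x; rewrite !inE; apply/negP => /andP[/Ae[i xi] /Ae[j xj]].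
  have /forallP/(_ j)/eqP := h i; apply; apply: phie; by rewrite -xi.
apply/setP => c; apply/idP/imsetP => [cG|[[u v]]].
  have := subsetP (edges_sub G) c cG; rewrite !inE => /andP[_ /cards2P[u [v [uv def_c]]]].
  exists (u, v) => //; rewrite inE /= uv -adjE // /adj -def_c //.
by rewrite inE /= => /andP[uv]; rewrite -adjE // => h ->.
Qed.

End Counting.

(** * Rank bounds for fixed [n] outside a small set of graphs *)

Lemma ex_sqrtn N : exists r, r * r <= N < r.+1 * r.+1.
Proof.
elim: N => [|N [r /andP[le lt]]]; first by exists 0.
have [lt'|ge] := ltnP N.+1 (r.+1 * r.+1); first by exists r; rewrite lt' leqW.
by exists r.+1; rewrite ge /=; nia.
Qed.

Lemma leq_8mul_expn2 l : 6 <= l -> 8 * l.+1 <= 2 ^ l.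
Proof.
elim: l => // l IHl; rewrite leq_eqVlt => /predU1P[<- //|/IHl le].
by rewrite expnS; lia.
Qed.

Lemma kneser_rank_bounds n (l := trunc_log 2 n) : 20 <= l ->
  exists2 A : {set sgraph 'I_n}, #|A| * 2 ^ n <= 2 * 2 ^ 'C(n, 2) &
    forall G, G \notin A ->
      n %/ (8 * l.+1) <= kneser_rank G /\ l %/ 20 * kneser_rank G <= 20 * n.
Proof.
move=> l_ge.
have n_gt0 : 0 < n by case: n @l l_ge => //=; rewrite trunc_log0.
have n_ge : 2 ^ l <= n by exact: trunc_logP.
have n_lt : n < 2 ^ l.+1 by exact: trunc_log_ltn.
have l8 : 8 * l.+1 <= n by apply: leq_trans n_ge; apply: leq_8mul_expn2; lia.
have [r /andP[r_le r_lt]] := ex_sqrtn (16 * n).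
(* About 4 sqrt n: two above the integer root, so that ['C(m, 2)] reaches [8 * n]. *)
pose m := r.+2.
have m2 : m * m <= 64 * n by rewrite /m; nia.
have mC : 8 * n <= 'C(m, 2).
  have := mul_bin_diag m 1; rewrite bin1 /m /=; nia.
(* The 8 makes the exponent [2 * l.+1 * (n * k)] at most n^2/4, which leaves room for another [n]
   below ['C(n, 2)]. *)
pose k := n %/ (8 * l.+1).
pose A1 := [set G : sgraph 'I_n | ~~ rich G m].
pose A2 := [set G : sgraph 'I_n | kneser_rank G < k].
have c1 : #|A1| * 2 ^ n <= 2 ^ 'C(n, 2).
  by have := @card_not_rich 'I_n m; rewrite card_ord; apply.
have c2 : #|A2| * 2 ^ n <= 2 ^ 'C(n, 2).
  have := @card_kneser_rank_lt 'I_n k; rewrite card_ord => h.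
  apply: leq_trans (leq_mul h (leqnn _)) _.
  have k_le : 8 * l.+1 * k <= n by rewrite mulnC leq_divM.
  have nk : n * k <= 2 ^ (2 * l.+1).
    by rewrite mul2n -addnn expnD leq_mul // ltnW // (leq_ltn_trans _ n_lt) //; nia.
  apply: (@leq_trans ((2 ^ (2 * l.+1)) ^ (n * k) * 2 ^ n)).
    rewrite leq_mul2r; apply/orP; right.
    by have [->//|nk_gt0] := posnP (n * k); rewrite leq_exp2r.
  rewrite -expnM -expnD leq_exp2l //.
  by have := mul_bin_diag n 1; rewrite bin1 -subn1; nia.
exists (A1 :|: A2).
  apply: leq_trans (leq_mul (leq_card_setU _ _).1 (leqnn _)) _.
  by rewrite mulnDl mul2n -addnn leq_add.
move=> G; rewrite !inE negb_or negbK -leqNgt => /andP[rG ->]; split=> //.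
pose t := l %/ 20; rewrite -/t.
have t_gt0 : 0 < t by rewrite divn_gt0.
have := rich_kneser_rank (isT : 0 < m) t_gt0 rG; rewrite card_ord => /leq_trans; apply.
(* [a] is the exponential factor of the error term. Since [t] is [l %/ 20], it is at most the fourth
   root of [n], and with [t < a] the error is at most [2 * (a * a * m)], which is linear in [n]. *)
pose a := 2 ^ (5 * t).
have a4 : (a * a) * (a * a) <= n.
  rewrite /a -!expnD; apply: leq_trans n_ge; rewrite leq_exp2l //.
  by have := leq_divM l 20; rewrite -/t; lia.
have ta : t < a.
  by apply: leq_trans (ltn_expl t (isT : 1 < 2)) _; rewrite leq_exp2l // leq_pmull.
have aE : 2 ^ t * 16 ^ t = a by rewrite /a -expnMn expnM.
have am : a * a * m <= 8 * n.
  by rewrite -leq_sqr; apply: (@leq_trans (n * (64 * n))); nia.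
have : 2 ^ t.+1 * (t * (16 ^ t * m)) <= 16 * n.
  have -> : 2 ^ t.+1 * (t * (16 ^ t * m)) = 2 * (t * (a * m)) by rewrite expnS -aE; lia.
  by nia.
have : t <= n by rewrite /t; nia.
lia.
Qed.

(* Natural logarithms and the limit *)
From mathcomp Require Import all_order all_algebra.
From mathcomp Require Import classical_sets boolp reals topology normedtype sequences exp.
From mathcomp Require Import lra.

Import Order.TTheory GRing.Theory Num.Theory.
Import numFieldNormedType.Exports.
Local Open Scope classical_set_scope.
Local Open Scope ring_scope.

(** Both sides come from ln (1 + x) <= x, at x = -1/2 and x = 1. *)
Lemma ln2_bounds (R : realType) : 1 / 2 <= ln (2 : R) <= 1.
Proof.
apply/andP; split; last by have := @le_ln1Dx R 1 (ltac:(lra)); rewrite [1 + 1](_ : _ = 2).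
have : ln (1 + - (1 / 2) : R) <= - (1 / 2) by apply: le_ln1Dx; lra.
have -> : 1 + - (1 / 2) = 2^-1 :> R by lra.
by rewrite lnV ?posrE; lra.
Qed.

Lemma ln_trunc_log2 (R : realType) n (l := trunc_log 2 n) : (0 < n)%N ->
  l%:R / 2 <= ln (n%:R : R) <= l%:R + 1.
Proof.
move=> n_gt0; have /andP[h1 h2] := ln2_bounds R.
have /andP[le lt] := @trunc_log_bounds 2 n isT n_gt0; rewrite -/l in le lt.
have n0 : (0 : R) < n%:R by rewrite ltr0n.
have le1 : l%:R * ln (2 : R) <= ln n%:R.
  rewrite mulr_natl -lnXn ?ltr0n // ler_ln ?posrE ?exprn_gt0 ?ltr0n //.
  by rewrite -natrX ler_nat.
have le2 : ln n%:R <= l.+1%:R * ln (2 : R).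
  rewrite mulr_natl -lnXn ?ltr0n // ler_ln ?posrE ?exprn_gt0 ?ltr0n //.
  by rewrite -natrX ler_nat ltnW.
have l0 : (0 : R) <= l%:R by rewrite ler0n.
by rewrite -natr1 in le2; apply/andP; split; nra.
Qed.

Theorem theorem1 (R : realType) :
  exists c1 c2 : R,
    [/\ 0 < c1, c1 < c2 &
        (fun n : nat =>
           uniform_prob R (fun G : sgraph 'I_n =>
             c1 * (n%:R / ln n%:R) < (kneser_rank G)%:R < c2 * (n%:R / ln n%:R)))
          @ \oo --> (1 : R)].
Proof.
(* The rank exceeds n / (32 l) and ln n >= l / 2, which gives 1/64. Also (l + 1) times the rank is
   at most 800 n and ln n <= l + 1; 801 makes the inequality strict. *)
exists (1 / 64), 801; split; [lra|lra|].
apply: (@squeeze_cvgr _ _ _ _ (fun n => 1 - 2 * (2^-1 : R) ^+ n) (fun=> 1)).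
- near=> n.
  have n_ge : (2 ^ 20 <= n)%N by near: n; exact: nbhs_infty_ge.
  have n_gt0 : (0 < n)%N by apply: leq_trans n_ge; rewrite expn_gt0.
  pose l := trunc_log 2 n.
  have l_ge : (20 <= l)%N by apply: trunc_log_max.
  have [A cA hA] := kneser_rank_bounds l_ge.
  have n0 : (0 : R) < n%:R by rewrite ltr0n.
  have /andP[ln1 ln2] := @ln_trunc_log2 R n n_gt0; rewrite -/l in ln1 ln2.
  have l20 : (20 : R) <= l%:R by rewrite ler_nat.
  have ln0 : 0 < ln (n%:R : R) by lra.
  rewrite /uniform_prob; set P := (X in #|X|).
  have cT : (0 : R) < #|{: sgraph 'I_n}|%:R by rewrite ltr0n card_sgraph expn_gt0.
  have AP : ~: A \subset P.
    apply/fintype.subsetP => G; rewrite finset.in_setC => /hA[lo up].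
    rewrite unfold_in /P mulrA mulrA ltr_pdivrMr // ltr_pdivlMr //.
    have rk0 : (0 : R) <= (kneser_rank G)%:R by rewrite ler0n.
    apply/andP; split.
      have k_gt0 : (0 < n %/ (8 * l.+1))%N.
        rewrite divn_gt0 //; apply: leq_trans (trunc_logP (isT : 1 < 2)%N n_gt0).
        by apply: leq_8mul_expn2; lia.
      have : (n < 32 * l * kneser_rank G)%N.
        have := ltn_ceil n (isT : 0 < 8 * l.+1)%N.
        by move: (n %/ _)%N k_gt0 lo => k; nia.
      rewrite -(ltr_nat R) !natrM; nra.
    have : (l.+1 * kneser_rank G <= 800 * n)%N.
      have := ltn_ceil l (isT : 0 < 20)%N.
      have : (0 < l %/ 20)%N by rewrite divn_gt0.
      by move: (l %/ 20)%N up => t; nia.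
    by rewrite -(ler_nat R) !natrM -natr1; nra.
  rewrite ler_pdivlMr // ler_pdivrMr // mul1r ler_nat max_card andbT.
  apply: (@le_trans _ _ (#|~: A|%:R)); last first.
    by rewrite ler_nat subset_leq_card.
  have -> : #|~: A|%:R = #|{: sgraph 'I_n}|%:R - #|A|%:R :> R.
    by rewrite -(cardsC A) natrD addrC addKr.
  rewrite mulrBl mul1r lerD2l lerN2 exprVn mulrAC ler_pdivlMr ?exprn_gt0 //.
  by rewrite card_sgraph card_ord -natrX -natrM -natrM ler_nat.
- rewrite -[X in _ --> X]subr0 -[X in _ - X](mulr0 2).
  apply: cvgB; first exact: cvg_cst.
  apply: cvgMr; apply: cvg_expr; rewrite ger0_norm; lra.
- exact: cvg_cst.
Unshelve. all: by end_near.
Qed.
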